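(* Let $\mathbb{P}$ be a logic program, let $l_1,\dots,l_k$ be lists of atoms in $At(n)$ and let $\theta\in\mathbf{L}[n,m]$ be a substitution. The following two equalities hold: $$[\![\theta^{l}\,l_1::\dots::\theta^{l}\,l_k]\!]_{p^\sharp_\delta}=\overline{\theta}[\![l_1]\!]_{p^\sharp_\delta}\,\overline{::}\,\dots\,\overline{::}\,\overline{\theta}[\![l_k]\!]_{p^\sharp_\delta}=\overline{\theta}\big([\![l_1]\!]_{p^\sharp_\delta}\,\overline{::}\,\dots\,\overline{::}\,[\![l_k]\!]_{p^\sharp_\delta}\big),$$ where $\theta^{l}=\breve{\mathcal{L}}(At)(\theta):\breve{\mathcal{L}}At(n)\to\breve{\mathcal{L}}At(m)$, $\overline\theta=\Omega(\theta):\Omega(n)\to\Omega(m)$, $a_1::\dots::a_k$ denotes the concatenation of lists of atoms, and $T_1\,\overline{::}\dots\overline{::}\,T_k$ denotes the value of the map $\overline{::}:\breve{\mathcal{L}}\Omega\to\Omega$ (at the relevant object of $\mathbf{L}$) on the list $[T_1,\dots,T_k]$.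
   Context: Fix a signature $\Sigma$ (at most countable) and predicate symbols. $\mathbf{L}$ denotes $\mathbf{L}_\Sigma^{op}$: objects are natural numbers; an arrow (substitution) $n\to m$ is an $n$-tuple of $\Sigma$-terms with variables among $x_1,\dots,x_m$; composition is substitution. The presheaf $At:\mathbf{L}\to\mathbf{Set}$ maps $n$ to the set of atoms with variables among $x_1,\dots,x_n$, $At(\theta)(A)=A\theta$. A logic program is a finite set of clauses $H\leftarrow B_1,\dots,B_k$ ($k\ge 0$). $\mathcal{L}$ is the list monad on $\mathbf{Set}$ and $\mathcal{P}_c$ the countable powerset functor; $\breve{\mathcal{L}},\breve{\mathcal{P}_c}$ are their extensions to $\mathbf{Set}^{\mathbf{L}}$ by postcomposition; the multiplication of $\breve{\mathcal{L}}$ is componentwise list concatenation, written $::$. $\mathcal{U}:\mathbf{Set}^{\mathbf{L}}\to\mathbf{Set}^{|\mathbf{L}|}$ is the forgetful functor ($|\mathbf{L}|$ the discrete category on the objects of $\mathbf{L}$), with right adjoint $\mathcal{K}(F)(n)=\prod_{\theta:n\to m}F(m)$ (product over all arrows of $\mathbf{L}$ with source $n$), $\mathcal{K}(F)(\theta)(\dot x)=\langle\dot x(\sigma\circ\theta)\rangle_{\sigma}$. Put $\mathcal{R}=\mathcal{K}\mathcal{U}\breve{\mathcal{P}_c}$, so $\mathcal{R}(G)(n)=\prod_{\theta:n\to m}\mathcal{P}_c(G(m))$. The saturated coalgebra $p^\sharp:At\to\mathcal{R}\breve{\mathcal{L}}(At)$ of $\mathbb{P}$ is given, for $A\in At(n)$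 and $\sigma:n\to m$, by $p^\sharp(n)(A)(\sigma)=\{[B_1\tau,\dots,B_k\tau]\mid(H\leftarrow B_1,\dots,B_k)\in\mathbb{P},\ A\sigma=H\tau,\ B_1\tau,\dots,B_k\tau\in At(m)\}$. $\delta:\breve{\mathcal{L}}\mathcal{R}\Rightarrow\mathcal{R}\breve{\mathcal{L}}$ is the distributive law $\delta_G(n)([\dot x_1,\dots,\dot x_k])=\langle\{[y_1,\dots,y_k]\mid y_i\in\dot x_i(\theta)\}\rangle_{\theta:n\to m}$. Define $p^\sharp_\delta=\mathcal{R}(::)\circ\delta_{\breve{\mathcal{L}}At}\circ\breve{\mathcal{L}}p^\sharp:\breve{\mathcal{L}}At\to\mathcal{R}\breve{\mathcal{L}}At$, i.e. $p^\sharp_\delta(n)([A_1,\dots,A_k])(\theta)=\{m_1::\dots::m_k\mid m_i\in p^\sharp(n)(A_i)(\theta)\}$. Let $c:\Omega\to\breve{\mathcal{L}}At\times\mathcal{R}(\Omega)$ be the final $\breve{\mathcal{L}}At\times\mathcal{R}(\cdot)$-coalgebra in $\mathbf{Set}^{\mathbf{L}}$ ($\Omega=\mathcal{C}(\mathcal{R})(\breve{\mathcal{L}}At)$). Let $\delta'_G=((::)\times\delta_G)\circ\langle\breve{\mathcal{L}}\pi_1,\breve{\mathcal{L}}\pi_2\rangle:\breve{\mathcal{L}}(\breve{\mathcal{L}}At\times\mathcal{R}G)\to\breve{\mathcal{L}}At\times\mathcal{R}\breve{\mathcal{L}}G$. The map $\overline{::}:\breve{\mathcal{L}}\Omega\to\Omega$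 is the unique coalgebra morphism from $(\breve{\mathcal{L}}\Omega,\delta'_\Omega\circ\breve{\mathcal{L}}c)$ to $(\Omega,c)$. The semantics $[\![\cdot]\!]_{p^\sharp_\delta}:\breve{\mathcal{L}}At\to\Omega$ is the unique coalgebra morphism from $(\breve{\mathcal{L}}At,\langle id,p^\sharp_\delta\rangle)$ to $(\Omega,c)$ (it underlies the unique morphism to the final $\delta'$-bialgebra $(\Omega,\overline{::},c)$); for $l\in\breve{\mathcal{L}}At(n)$, $[\![l]\!]_{p^\sharp_\delta}$ means $[\![\cdot]\!]_{p^\sharp_\delta}(n)(l)$. *)

(* Defs.v *)
From Stdlib Require List.
From mathcomp Require Import all_boot.
From mathcomp Require Import boolp classical_sets functions cardinality.

Set Implicit Arguments.
Unset Strict Implicit.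
Unset Printing Implicit Defensive.

Local Open Scope classical_set_scope.

Record type_functor := TypeFunctor {
  tobj :> Type -> Type;
  tmap : forall X Y : Type, (X -> Y) -> tobj X -> tobj Y;
  tmap_id : forall X (x : tobj X), tmap id x = x;
  tmap_comp : forall X Y Z (g : Y -> Z) (f : X -> Y) (x : tobj X),
    tmap (g \o f) x = tmap g (tmap f x) }.

Arguments tmap _ {X Y} _ _.

Lemma seq_map_comp X Y Z (g : Y -> Z) (f : X -> Y) (s : seq X) :
  map (g \o f) s = map g (map f s).
Proof. exact: map_comp. Qed.

Definition ListF : type_functor :=
  @TypeFunctor (fun X => seq X) (fun X Y f => map f) map_id seq_map_comp.

Record cset (X : Type) := CSet {
  cset_set :> X -> Prop;
  cset_countable : countable cset_set }.

Lemma cset_eq X (A B : cset X) : (forall x, A x <-> B x) -> A = B.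
Proof.
case: A B => [A cA] [B cB] /= AB.
have E : A = B by apply/funext => x; apply/propext.
by rewrite -{}E in cB *; congr CSet; exact: Prop_irrelevance.
Qed.

Lemma countable_image X Y (f : X -> Y) (A : set X) :
  countable A -> countable (f @` A).
Proof. exact/sub_countable/card_image_le. Qed.

Definition cset_map X Y (f : X -> Y) (A : cset X) : cset Y :=
  CSet (countable_image f (cset_countable A)).

Lemma cset_map_id X (A : cset X) : cset_map id A = A.
Proof. by apply: cset_eq => x /=; split=> [[y ? <-]|?] //; exists x. Qed.

Lemma cset_map_comp X Y Z (g : Y -> Z) (f : X -> Y) (A : cset X) :
  cset_map (g \o f) A = cset_map g (cset_map f A).
Proof. 
apply: cset_eq => z /=; split=> [[x Ax <-]|[y [x Ax <-] <-]]; last by exists x.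
by exists (f x) => //; exists x.
Qed.

Definition CPowF : type_functor := TypeFunctor cset_map_id cset_map_comp.

Record signature := Signature {
  fsym : Type;
  farity : fsym -> nat;
  fsym_countable : countable [set: fsym] }.

Record predicates := Predicates {
  psym : Type;
  parity : psym -> nat }.

Inductive term (Sg : signature) (V : Type) : Type :=
| Var of V
| App (f : fsym Sg) of ('I_(farity f) -> term Sg V).

Arguments Var {Sg V} _.
Arguments App {Sg V} f _.

Record atom (Sg : signature) (Pr : predicates) (V : Type) := Atom {
  apred : psym Pr;
  aargs : 'I_(parity apred) -> term Sg V }.

Arguments Atom {Sg Pr V} apred aargs.
Arguments aargs {Sg Pr V} a _.

Section Syntax.
Variables (Sg : signature) (Pr : predicates).

Fixpoint tsubst (V W : Type) (s : V -> term Sg W) (t : term Sg V) : term Sg W :=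
  match t with
  | Var v => s v
  | App f ts => App f (fun i => tsubst s (ts i))
  end.

Definition asubst (V W : Type) (s : V -> term Sg W) (A : atom Sg Pr V) :
  atom Sg Pr W := Atom (apred A) (fun i => tsubst s (aargs A i)).

Lemma tsubst_id V (t : term Sg V) : tsubst Var t = t.
Proof. by elim: t => [v|f ts IH] //=; congr App; apply/funext. Qed.

Lemma tsubst_comp V W X (s : V -> term Sg W) (r : W -> term Sg X) t :
  tsubst r (tsubst s t) = tsubst (tsubst r \o s) t.
Proof. by elim: t => [v|f ts IH] //=; congr App; apply/funext. Qed.

Lemma asubst_id V (A : atom Sg Pr V) : asubst Var A = A.
Proof. by case: A => p a; congr Atom; apply/funext => i; exact: tsubst_id. Qed.

Lemma asubst_comp V W X (s : V -> term Sg W) (r : W -> term Sg X)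
    (A : atom Sg Pr V) :
  asubst r (asubst s A) = asubst (tsubst r \o s) A.
Proof. by congr Atom; apply/funext => i; exact: tsubst_comp. Qed.

(* Clauses are written over the countable set [nat] of all variables. *)
Record clause := Clause {
  chead : atom Sg Pr nat;
  cbody : seq (atom Sg Pr nat) }.

Record program := Program {
  clauses : set clause;
  program_finite : finite_set clauses }.

(* [At(n)] is [atom Sg Pr 'I_n]; [inject] views it as a subset of the atoms
   over all variables. *)
Definition inject n : atom Sg Pr 'I_n -> atom Sg Pr nat :=
  asubst (fun i : 'I_n => Var (i : nat)).

Lemma term_code (V : countType) :
  exists f : term Sg V -> GenTree.tree (nat + V), injective f.
Proof.
have /countable_injP[c cI] := fsym_countable Sg.
pose code := fix code (t : term Sg V) : GenTree.tree (nat + V) :=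
  match t with
  | Var v => GenTree.Leaf (inr v)
  | App f ts => GenTree.Node (c f) [seq code (ts i) | i <- enum 'I_(farity f)]
  end.
exists code; elim=> [v|f ts IH] [w|g us] //=; first by case=> ->.
case=> cfg; have E : f = g by apply: cI => //; rewrite inE.
case: _ / E in us {cfg} * => /eq_in_map E; congr App; apply/funext => i.
by apply: IH; apply: E; rewrite mem_enum.
Qed.

Lemma atom_eq V (A B : atom Sg Pr V) : apred A = apred B ->
  [seq aargs A i | i <- enum 'I_(parity (apred A))] =
  [seq aargs B i | i <- enum 'I_(parity (apred B))] -> A = B.
Proof.
case: A B => [p a] [q b] /= E; case: _ / E b => b E; congr Atom.
apply/funext => i; move: (mem_enum 'I_(parity p) i).
elim: (enum _) E => [|j s IH] //= [abj abs].
by rewrite inE => /orP[/eqP ->|/IH->].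
Qed.

Lemma countable_instances (n : nat) (ps : seq (psym Pr)) :
  countable [set bs : seq (atom Sg Pr 'I_n) | map (@apred Sg Pr 'I_n) bs = ps].
Proof.
have [f fI] := term_code 'I_n; apply/countable_injP.
exists (fun bs => pickle
  [seq [seq f (aargs b i) | i <- enum 'I_(parity (apred b))] | b <- bs]).
move=> b1 b2; rewrite !inE /= => E1 E2 /(pcan_inj pickleK).
rewrite -{}E2 {ps} in E1 *.
elim: b1 b2 E1 => [|a1 b1 IH] [|a2 b2] //= [pa pb] [aa /IH->] //.
congr (_ :: _); apply: atom_eq => //; apply: (inj_map fI).
by rewrite -[LHS]map_comp -[RHS]map_comp.
Qed.

End Syntax.

Section Presheaves.
Variable Sg : signature.

(* [arrow n m] is the hom-set L[n,m]: n-tuples of terms over m variables. *)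
Definition arrow (n m : nat) : Type := 'I_n -> term Sg 'I_m.

Definition arrow_id n : arrow n n := Var.

Definition arrow_comp n m k (s : arrow m k) (t : arrow n m) : arrow n k :=
  fun i => tsubst s (t i).

Lemma arrow_id_comp n m (t : arrow n m) : arrow_comp (@arrow_id m) t = t.
Proof. by apply/funext => i; exact: tsubst_id. Qed.

Lemma arrow_comp_id n m (t : arrow n m) : arrow_comp t (@arrow_id n) = t.
Proof. by []. Qed.

Lemma arrow_compA n m k l (r : arrow k l) (s : arrow m k) (t : arrow n m) :
  arrow_comp r (arrow_comp s t) = arrow_comp (arrow_comp r s) t.
Proof. by apply/funext => i; exact: tsubst_comp. Qed.

(* Objects and arrows of Set^L. *)
Record psh := Psh {
  pobj :> nat -> Type;
  pmor : forall n m, arrow n m -> pobj n -> pobj m;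
  pmor_id : forall n (x : pobj n), pmor (@arrow_id n) x = x;
  pmor_comp : forall n m k (s : arrow m k) (t : arrow n m) (x : pobj n),
    pmor (arrow_comp s t) x = pmor s (pmor t x) }.

Arguments pmor _ {n m} _ _.

Record hom (G H : psh) := Hom {
  happ :> forall n, G n -> H n;
  hnat : forall n m (t : arrow n m) (x : G n),
    happ (pmor G t x) = pmor H t (happ x) }.

Arguments happ {G H} _ {n} _.

Definition hom_eq (G H : psh) (f g : hom G H) : Prop :=
  forall n (x : G n), happ f x = happ g x.

Definition hom_id (G : psh) : hom G G :=
  @Hom G G (fun n x => x) (fun _ _ _ _ => erefl).

Program Definition hom_comp (G H K : psh) (g : hom H K) (f : hom G H) :
  hom G K := @Hom G K (fun n x => happ g (happ f x)) _.
Next Obligation. by rewrite !hnat. Qed.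

Record functor := Functor {
  fobj :> psh -> psh;
  fmap : forall G H, hom G H -> hom (fobj G) (fobj H);
  fmap_id : forall G, hom_eq (fmap (hom_id G)) (hom_id (fobj G));
  fmap_comp : forall G H K (g : hom H K) (f : hom G H),
    hom_eq (fmap (hom_comp g f)) (hom_comp (fmap g) (fmap f)) }.

Arguments fmap _ {G H} _.

Section Postcomposition.
Variable T : type_functor.

Program Definition breve_obj (G : psh) : psh :=
  @Psh (fun n => T (G n)) (fun n m t => tmap T (pmor G t)) _ _.
Next Obligation.
by rewrite -[RHS]tmap_id; congr tmap; apply/funext => y; exact: pmor_id.
Qed.
Next Obligation.
by rewrite -tmap_comp; congr tmap; apply/funext => y; exact: pmor_comp.
Qed.

Program Definition breve_map (G H : psh) (f : hom G H) :
  hom (breve_obj G) (breve_obj H) :=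
  @Hom (breve_obj G) (breve_obj H) (fun n => tmap T (@happ _ _ f n)) _.
Next Obligation.
by rewrite -!tmap_comp; congr tmap; apply/funext => y; exact: hnat.
Qed.

Program Definition breve : functor := @Functor breve_obj breve_map _ _.
Next Obligation. by move=> n x /=; rewrite -[RHS](tmap_id x). Qed.
Next Obligation. by move=> n x /=; rewrite -tmap_comp. Qed.

End Postcomposition.

Definition Lb : functor := breve ListF.
Definition Pcb : functor := breve CPowF.

(* Set^|L|: families of types indexed by the objects of L. *)
Definition family : Type := nat -> Type.

Definition fhom (F G : family) : Type := forall n, F n -> G n.

Definition U_obj (G : psh) : family := pobj G.

Definition U_map (G H : psh) (f : hom G H) : fhom (U_obj G) (U_obj H) :=
  @happ G H f.

Program Definition K_obj (F : family) : psh :=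
  @Psh (fun n => forall m, arrow n m -> F m)
    (fun n m t x k s => x k (arrow_comp s t)) _ _.
Next Obligation.
do 2!apply: functional_extensionality_dep => ?; by rewrite arrow_compA.
Qed.

Definition K_map (F G : family) (f : fhom F G) : hom (K_obj F) (K_obj G) :=
  @Hom (K_obj F) (K_obj G) (fun n x m s => f m (x m s)) (fun _ _ _ _ => erefl).

Program Definition R : functor :=
  @Functor (fun G => K_obj (U_obj (Pcb G)))
    (fun G H f => K_map (U_map (fmap Pcb f))) _ _.
Next Obligation.
move=> n x; do 2!apply: functional_extensionality_dep => ?.
exact: cset_map_id.
Qed.
Next Obligation.
move=> n x; do 2!apply: functional_extensionality_dep => ?.
exact: cset_map_comp.
Qed.

Program Definition prod_psh (G H : psh) : psh :=
  @Psh (fun n => (G n * H n)%type)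
    (fun n m t x => (pmor G t x.1, pmor H t x.2)) _ _.
Next Obligation. by rewrite !pmor_id. Qed.
Next Obligation. by rewrite !pmor_comp. Qed.

Definition proj1h (G H : psh) : hom (prod_psh G H) G :=
  @Hom (prod_psh G H) G (fun n x => x.1) (fun _ _ _ _ => erefl).

Definition proj2h (G H : psh) : hom (prod_psh G H) H :=
  @Hom (prod_psh G H) H (fun n x => x.2) (fun _ _ _ _ => erefl).

Program Definition pairh (K G H : psh) (f : hom K G) (g : hom K H) :
  hom K (prod_psh G H) :=
  @Hom K (prod_psh G H) (fun n x => (happ f x, happ g x)) _.
Next Obligation. by rewrite !hnat. Qed.

Definition crossh (G H G' H' : psh) (f : hom G G') (g : hom H H') :
  hom (prod_psh G H) (prod_psh G' H') :=
  pairh (hom_comp f (proj1h G H)) (hom_comp g (proj2h G H)).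

Program Definition const_prod (A : psh) (F : functor) : functor :=
  @Functor (fun G => prod_psh A (F G))
    (fun G H f => crossh (hom_id A) (fmap F f)) _ _.
Next Obligation. by move=> n [a x]; congr pair; exact: fmap_id. Qed.
Next Obligation. by move=> n [a x]; congr pair; exact: fmap_comp. Qed.

Record coalgebra (F : functor) := Coalgebra {
  carrier :> psh;
  costr : hom carrier (F carrier) }.

Arguments costr {F} _.

Definition is_coalg_hom (F : functor) (X Y : coalgebra F) (f : hom X Y) : Prop :=
  hom_eq (hom_comp (costr Y) f) (hom_comp (fmap F f) (costr X)).

Record final_coalgebra (F : functor) := FinalCoalgebra {
  final :> coalgebra F;
  corec : forall X : coalgebra F, hom X final;
  corec_hom : forall X : coalgebra F, is_coalg_hom (corec X);
  corec_unique : forall (X : coalgebra F) (f : hom X final),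
    is_coalg_hom f -> hom_eq f (corec X) }.

Arguments corec {F} _ _.

(* Multiplication of the monad [Lb]. *)
Program Definition concat (G : psh) : hom (Lb (Lb G)) (Lb G) :=
  @Hom (Lb (Lb G)) (Lb G) (fun n (x : seq (seq (G n))) => flatten x) _.
Next Obligation. by rewrite map_flatten. Qed.

Definition choices X (xs : seq (cset X)) : set (seq X) :=
  [set ys | List.Forall2 (fun y (x : cset X) => x y) ys xs].

Lemma countable_choices X (xs : seq (cset X)) : countable (choices xs).
Proof.
elim: xs => [|x xs IH].
  apply: sub_countable (countable1 [::]); apply: subset_card_le => ys H.
  by inversion H.
apply: sub_countable (countable_image (fun p => p.1 :: p.2)
  (countableX (cset_countable x) IH)).
apply: subset_card_le => ys H; inversion H as [|y x' ys' xs' Hy Hys]; subst.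
by exists (y, ys').
Qed.

Program Definition delta (G : psh) : hom (Lb (R G)) (R (Lb G)) :=
  @Hom (Lb (R G)) (R (Lb G))
    (fun n (xs : seq (R G n)) m (t : arrow n m) =>
       CSet (countable_choices [seq x m t | x <- xs])) _.
Next Obligation.
do 2!apply: functional_extensionality_dep => ?; apply: cset_eq => ys /=.
by rewrite -map_comp.
Qed.

Section LogicProgram.
Variables (Pr : predicates) (P : program Sg Pr).

Definition At : psh :=
  @Psh (fun n => atom Sg Pr 'I_n) (fun n m t => asubst t)
    (fun n => @asubst_id Sg Pr 'I_n)
    (fun n m k s t A => esym (asubst_comp t s A)).

(* The substitution [t] is defined on all variables; that the instances of the
   body atoms under [t] lie in [At(m)] is expressed by [inject]. *)
Definition resolvents n (A : At n) m (s : arrow n m) : set (Lb At m) :=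
  [set Bs | exists (C : clause Sg Pr) (t : nat -> term Sg nat),
    [/\ clauses P C, inject (asubst s A) = asubst t (chead C) &
        [seq inject B | B <- Bs] = [seq asubst t B | B <- cbody C]]].

Lemma countable_resolvents n (A : At n) m (s : arrow n m) :
  countable (resolvents A s).
Proof.
apply: sub_countable (bigcup_countable
  (finite_set_countable (@program_finite _ _ P))
  (fun C _ => @countable_instances Sg Pr m (map (@apred _ _ _) (cbody C)))).
apply: subset_card_le => Bs [C [t [PC _ E]]]; exists C => //=.
have := congr1 (map (@apred _ _ _)) E.
by rewrite -[LHS]map_comp -[RHS]map_comp.
Qed.

Program Definition psharp : hom At (R (Lb At)) :=
  @Hom At (R (Lb At))
    (fun n A m (s : arrow n m) => CSet (countable_resolvents A s)) _.
Next Obligation.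
do 2!apply: functional_extensionality_dep => ?; apply: cset_eq => Bs /=.
by rewrite /resolvents /= asubst_comp.
Qed.

Definition psharp_delta : hom (Lb At) (R (Lb At)) :=
  hom_comp (fmap R (concat At)) (hom_comp (delta (Lb At)) (fmap Lb psharp)).

Definition LR : functor := const_prod (Lb At) R.

Definition delta' (G : psh) : hom (Lb (LR G)) (LR (Lb G)) :=
  hom_comp (crossh (concat At) (delta G))
    (pairh (fmap Lb (proj1h (Lb At) (R G))) (fmap Lb (proj2h (Lb At) (R G)))).

Definition goal_coalgebra : coalgebra LR :=
  @Coalgebra LR (Lb At) (pairh (hom_id (Lb At)) psharp_delta).

Variable Omega : final_coalgebra LR.

Definition concat_bar : hom (Lb Omega) Omega :=
  corec Omega (@Coalgebra LR (Lb Omega)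
    (hom_comp (delta' Omega) (fmap Lb (costr Omega)))).

Definition semantics : hom (Lb At) Omega := corec Omega goal_coalgebra.

End LogicProgram.

End Presheaves.

Arguments pmor {Sg} _ {n m} _ _.
Arguments happ {Sg G H} _ {n} _.
Arguments fmap {Sg} _ {G H} _.
Arguments costr {Sg F} _.
Arguments corec {Sg F} _ _.

(* Trees with countable branching, modulo bisimilarity, form a final coalgebra
   of [const_prod A (R Sg)]; with [A := Lb Sg (At Sg Pr)] this shows that
   [final_coalgebra (LR Sg Pr)] is inhabited. *)
Section FinalCoalgebra.
Variables (Sg : signature) (A : psh Sg).

Let F : functor Sg := const_prod A (R Sg).

CoInductive tree (n : nat) : Type :=
  Node of A n & (forall m, arrow Sg n m -> nat -> option (tree m)).

Definition label n (x : tree n) : A n := let: Node a _ := x in a.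

Definition children n (x : tree n) : forall m, arrow Sg n m -> nat -> option (tree m) :=
  let: Node _ c := x in c.

Definition bisimulation (r : forall n, tree n -> tree n -> Prop) : Prop :=
  forall n (x y : tree n), r n x y -> label x = label y /\
    forall m (s : arrow Sg n m),
      (forall i x', children x s i = Some x' ->
         exists j y', children y s j = Some y' /\ r m x' y') /\
      (forall j y', children y s j = Some y' ->
         exists i x', children x s i = Some x' /\ r m x' y').

Definition bisimilar n (x y : tree n) : Prop :=
  exists2 r, bisimulation r & r n x y.

Lemma bisimilarP : bisimulation bisimilar.
Proof.
move=> n x y [r br rxy]; have [lE cE] := br _ _ _ rxy; split=> // m s.
have [c1 c2] := cE m s; split=> [i x' /c1[j [y' [Ey rE]]]|j y' /c2[i [x' [Ex rE]]]].
  by exists j, y'; split=> //; exists r.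
by exists i, x'; split=> //; exists r.
Qed.

Lemma bisimilar_refl n (x : tree n) : bisimilar x x.
Proof.
exists (fun _ => eq) => // {}n {}x _ <-; split=> // m s.
by split=> i x' Ex; exists i, x'.
Qed.

Lemma bisimilar_sym n (x y : tree n) : bisimilar x y -> bisimilar y x.
Proof.
exists (fun n u v => bisimilar v u) => // {H}n' u v /bisimilarP[lE cE].
by split=> // m s; have [c1 c2] := cE m s; split=> i z;
  [move=> /c2|move=> /c1].
Qed.

Lemma bisimilar_trans n (x y z : tree n) :
  bisimilar x y -> bisimilar y z -> bisimilar x z.
Proof.
move=> xy yz.
exists (fun n u w => exists2 v : tree n, bisimilar u v & bisimilar v w);
  last by exists y.
move=> {xy yz x y z}n' u w [v /bisimilarP[l1 c1] /bisimilarP[l2 c2]].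
split=> [|m s]; first exact: etrans l1 l2.
have [c11 c12] := c1 m s; have [c21 c22] := c2 m s.
split=> [i u' /c11[j [v' [/c21[k [w' [Ew b2]]] b1]]]|
         k w' /c22[j [v' [/c12[i [u' [Eu b1]]] b2]]]].
  by exists k, w'; split=> //; exists v'.
by exists i, u'; split=> //; exists v'.
Qed.

Definition qtree n : Type := {c : tree n -> Prop | exists x, c = bisimilar x}.

Definition qclass n (x : tree n) : qtree n :=
  exist _ (bisimilar x) (ex_intro _ x erefl).

Definition qrepr n (q : qtree n) : tree n := projT1 (cid (proj2_sig q)).

Lemma qclassK n (q : qtree n) : qclass (qrepr q) = q.
Proof.
rewrite /qrepr; case: cid => x /=; case: q => c /= e E; subst c.
by congr exist; exact: Prop_irrelevance.
Qed.

Lemma qclassE n (x y : tree n) : qclass x = qclass y <-> bisimilar x y.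
Proof.
split=> [[->]|xy]; first exact: bisimilar_refl.
have E : bisimilar x = bisimilar y.
  apply/funext => z; apply/propext; split; last exact: bisimilar_trans.
  exact/bisimilar_trans/bisimilar_sym.
rewrite /qclass; move: (ex_intro _ _ _); rewrite E => e.
by congr exist; exact: Prop_irrelevance.
Qed.

Lemma qrepr_class n (x : tree n) : bisimilar (qrepr (qclass x)) x.
Proof. by apply/qclassE; rewrite qclassK. Qed.

Definition tact n m (t : arrow Sg n m) (x : tree n) : tree m :=
  Node (pmor A t (label x)) (fun k s => children x (arrow_comp s t)).

Lemma tact_bisimilar n m (t : arrow Sg n m) (x y : tree n) :
  bisimilar x y -> bisimilar (tact t x) (tact t y).
Proof.
move=> xy; exists (fun n u v => bisimilar u v \/
  exists k (t : arrow Sg k n) x y, [/\ bisimilar x y, u = tact t x & v = tact t y]);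
  last by right; exists n, t, x, y.
move=> {}n' u v [/bisimilarP[lE cE]|[k [t' [x' [y' [/bisimilarP[lE cE] -> ->]]]]]].
  split=> // k s; have [c1 c2] := cE k s.
  by split=> i z; [move=> /c1|move=> /c2] => -[j [z' [? ?]]]; exists j, z'; split=> //; left.
split=> /= [|k' s]; first by rewrite lE.
have [c1 c2] := cE k' (arrow_comp s t').
by split=> i z; [move=> /c1|move=> /c2] => -[j [z' [? ?]]]; exists j, z'; split=> //; left.
Qed.

Lemma tree_eta n (x : tree n) : x = Node (label x) (children x).
Proof. by case: x. Qed.

Program Definition qtree_psh : psh Sg :=
  @Psh Sg qtree (fun n m t q => qclass (tact t (qrepr q))) _ _.
Next Obligation.
rewrite -[RHS]qclassK; congr qclass; rewrite [RHS]tree_eta /tact pmor_id.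
by congr Node; do 2!apply: functional_extensionality_dep => ?.
Qed.
Next Obligation.
have -> : tact (arrow_comp s t) (qrepr x) = tact s (tact t (qrepr x)).
  rewrite /tact /= pmor_comp; congr Node.
  by do 2!apply: functional_extensionality_dep => ?; rewrite arrow_compA.
by apply/qclassE/tact_bisimilar/bisimilar_sym/qrepr_class.
Qed.

Definition qsub n (x : tree n) m (s : arrow Sg n m) : set (qtree m) :=
  [set q | exists i x', children x s i = Some x' /\ q = qclass x'].

Lemma qsub_countable n (x : tree n) m (s : arrow Sg n m) : countable (qsub x s).
Proof.
have H q : exists i, qsub x s q -> omap (@qclass m) (children x s i) = Some q.
  have [[i [x' [E ->]]]|nq] := pselect (qsub x s q); last by exists 0.
  by exists i; rewrite E.
have [f fP] := choice H; apply/countable_injP; exists f => q1 q2.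
rewrite !inE => /fP E1 /fP E2 E; rewrite E E2 in E1.
by case: E1.
Qed.

Lemma cset_enum X (B : cset X) :
  exists e : nat -> option X, forall x, B x <-> exists i, e i = Some x.
Proof.
have /countable_injP[f fI] := cset_countable B.
have H i : exists o : option X, forall x, o = Some x <-> B x /\ f x = i.
  have [[x [Bx fx]]|nx] := pselect (exists x, B x /\ f x = i).
    exists (Some x) => y; split=> [[<-]|[By fy]] //; congr Some.
    by apply: fI; rewrite ?inE // fx fy.
  by exists None => y; split=> // Hy; case: nx; exists y.
have [e eP] := choice H; exists e => x; split=> [Bx|[i /eP[]] //].
by exists (f x); apply/eP.
Qed.

Definition enum_cset X (B : cset X) : nat -> option X := projT1 (cid (cset_enum B)).

Lemma enum_csetP X (B : cset X) x : B x <-> exists i, enum_cset B i = Some x.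
Proof. by rewrite /enum_cset; case: cid => e /= ->. Qed.

Program Definition qtree_costr : hom qtree_psh (F qtree_psh) :=
  @Hom Sg qtree_psh (F qtree_psh)
    (fun n q => (label (qrepr q), fun m s => CSet (qsub_countable (qrepr q) s))) _.
Next Obligation.
have [lE cE] := bisimilarP (qrepr_class (tact t (qrepr x))).
congr pair; first exact: lE.
apply: functional_extensionality_dep => k.
apply: functional_extensionality_dep => s; apply: cset_eq => q /=.
have [c1 c2] := cE k s.
by split=> -[i [x' [+ ->]]]; [move=> /c1|move=> /c2] => -[j [y' [? /qclassE ?]]];
  exists j, y'; split.
Qed.

Definition qtree_coalgebra : coalgebra F := Coalgebra qtree_costr.

Section Corecursion.
Variable X : coalgebra F.

CoFixpoint grow n (x : X n) : tree n :=
  Node (happ (costr X) x).1 (fun m s i =>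
    match enum_cset ((happ (costr X) x).2 m s) i with
    | Some y => Some (grow y)
    | None => None
    end).

Lemma grow_children n (x : X n) m (s : arrow Sg n m) y :
  (exists i, children (grow x) s i = Some y) <->
  exists2 x', (happ (costr X) x).2 m s x' & y = grow x'.
Proof.
rewrite /=; split=> [[i]|[x' /enum_csetP[i E] ->]]; last by exists i; rewrite E.
by case E: enum_cset => [x'|] // [<-]; exists x' => //; apply/enum_csetP; exists i.
Qed.

Program Definition qtree_corec : hom X qtree_coalgebra :=
  @Hom Sg X qtree_coalgebra (fun n x => qclass (grow x)) _.
Next Obligation.
apply/qclassE; apply: bisimilar_trans (tact_bisimilar t _); last first.
  exact/bisimilar_sym/qrepr_class.
suff -> : grow (pmor X t x) = tact t (grow x) by exact: bisimilar_refl.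
by rewrite [LHS]tree_eta /tact /= hnat.
Qed.

Lemma qtree_corec_hom : is_coalg_hom qtree_corec.
Proof.
move=> n x /=.
have [lE cE] := bisimilarP (qrepr_class (grow x)).
congr pair; first exact: lE.
apply: functional_extensionality_dep => k.
apply: functional_extensionality_dep => s; apply: cset_eq => q /=.
have [c1 c2] := cE k s; split.
  case=> i [x' [/c1[j [y' [Ey b]]] ->]].
  have [|x'' ? Ey'] := (grow_children x s y').1; first by exists j.
  by exists x'' => //; apply/qclassE; rewrite -Ey'; exact: bisimilar_sym.
case=> x' Hx' <-; have [|j Ej] := (grow_children x s (grow x')).2; first by exists x'.
by have [i [z [Ez b]]] := c2 _ _ Ej; exists i, z; split=> //; apply/qclassE/bisimilar_sym.
Qed.

Lemma qtree_corec_unique (f : hom X qtree_coalgebra) :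
  is_coalg_hom f -> hom_eq f qtree_corec.
Proof.
move=> fP n x /=; rewrite -[LHS]qclassK; apply/qclassE.
exists (fun n u v => exists2 x : X n, qclass u = happ f x & v = grow x);
  last by exists x => //; exact: qclassK.
move=> {}n u v {x} [x ux ->].
have /bisimilarP[lE cE] : bisimilar u (qrepr (happ f x)).
  by apply/qclassE; rewrite qclassK.
have /= [l2 c2] := fP n x.
split=> [|m s]; first exact: etrans lE l2.
have [c1 c1'] := cE m s.
have {}c2 q := congr1 (fun g : (forall m, arrow Sg n m -> cset (qtree m)) => g m s q) c2.
split.
  move=> i u' /c1[j [y' [Ey b]]].
  have : qsub (qrepr (happ f x)) s (qclass y') by exists j, y'.
  have /= -> := c2 (qclass y') => -[x' Hx' fx'].
  have [|k Ek] := (grow_children x s (grow x')).2; first by exists x'.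
  exists k, (grow x'); split=> //; exists x' => //.
  by rewrite fx'; apply/qclassE.
move=> j v' Ev; have [|x' Hx' Ev'] := (grow_children x s v').1; first by exists j.
have : (fun q => exists2 y, (happ (costr X) x).2 m s y & happ f y = q) (happ f x').
  by exists x'.
rewrite /= in c2; rewrite -[X in X -> _](c2 (happ f x')) => -[i [y' [Ey fy]]].
have [k [u' [Eu b]]] := c1' _ _ Ey; exists k, u'; split=> //; exists x' => //.
by rewrite fy; apply/qclassE.
Qed.

End Corecursion.

Definition qtree_final : final_coalgebra F :=
  FinalCoalgebra qtree_corec_hom qtree_corec_unique.

End FinalCoalgebra.

(* Main.v *)
Require Import Defs.
From Stdlib Require List.
From mathcomp Require Import all_boot.
From mathcomp Require Import boolp.

(** Both [semantics \o concat] and [concat_bar \o Lb semantics] are coalgebra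
    morphisms into the final coalgebra, with source the coalgebra that [delta']
    induces on [Lb (Lb At)] from [<id, psharp_delta>]; hence they agree.  For
    the former one needs that [concat] is a coalgebra morphism, which follows
    from the compatibility of [delta] with the multiplication of [Lb]; for the
    latter that [delta'] is natural.  The second equality is naturality of
    [concat_bar]. *)

Set Implicit Arguments.
Unset Strict Implicit.
Unset Printing Implicit Defensive.

Lemma choices_nil X (ys : seq X) : choices [::] ys <-> ys = [::].
Proof. by split=> [H|->]; [inversion H | constructor]. Qed.

Lemma choices_cons X (x : cset X) xs ys :
  choices (x :: xs) ys <-> exists y ys', [/\ ys = y :: ys', x y & choices xs ys'].
Proof.
split=> [H|[y [ys' [-> xy xys]]]]; last by constructor.
by inversion H as [|y x' ys' xs' Hy Hys]; subst; exists y, ys'.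
Qed.

(** Pointwise form of the naturality of [delta]: a choice from the images is built by picking one
    preimage for each entry. *)
Lemma choices_map X Y (f : X -> Y) (xs : seq (cset X)) ys :
  choices [seq cset_map f x | x <- xs] ys <->
  exists2 zs, choices xs zs & [seq f z | z <- zs] = ys.
Proof.
elim: xs ys => [|x xs IH] ys /=.
  rewrite choices_nil; split=> [->|[zs /choices_nil -> <-]] //.
  by exists [::] => //; apply/choices_nil.
rewrite choices_cons; split=> [[y [ys' [-> [z xz <-] /IH[zs Hzs <-]]]]|].
  by exists (z :: zs) => //; apply/choices_cons; exists z, zs.
case=> _ /choices_cons[z [zs [-> xz Hzs]]] <-.
exists (f z), [seq f z | z <- zs]; split=> //; first by exists z.
by apply/IH; exists zs.
Qed.

Lemma choices_cat X (xs1 xs2 : seq (cset X)) ys :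
  choices (xs1 ++ xs2) ys <->
  exists ys1 ys2, [/\ ys = ys1 ++ ys2, choices xs1 ys1 & choices xs2 ys2].
Proof.
split=> [/List.Forall2_app_inv_r[ys1 [ys2 [? [? ->]]]]|[ys1 [ys2 [-> ? ?]]]].
  by exists ys1, ys2.
exact: List.Forall2_app.
Qed.

(** Pointwise form of [delta_concat]: a choice from the concatenation is cut, by [choices_cat], into
    one block per inner list. *)
Lemma choices_flatten X (xss : seq (seq (cset X))) ys :
  choices (flatten xss) ys <->
  exists2 yss,
    choices [seq CSet (countable_choices xs) | xs <- xss] yss & flatten yss = ys.
Proof.
elim: xss ys => [|xs xss IH] ys /=.
  rewrite choices_nil; split=> [->|[zs /choices_nil -> <-]] //.
  by exists [::] => //; apply/choices_nil.
rewrite choices_cat; split=> [[ys1 [_ [-> H1 /IH[yss H2 <-]]]]|].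
  by exists (ys1 :: yss) => //; apply/choices_cons; exists ys1, yss.
case=> _ /choices_cons[ys1 [yss [-> H1 H2]]] <-.
by exists ys1, (flatten yss); split=> //; apply/IH; exists yss.
Qed.

Lemma flatten_flatten X (s : seq (seq (seq X))) :
  flatten (flatten s) = flatten [seq flatten t | t <- s].
Proof. by elim: s => //= t s IH; rewrite flatten_cat IH. Qed.

Section DistributiveLaw.
Variable Sg : signature.

Lemma R_ext (G : psh Sg) n (x y : R Sg G n) :
  (forall m (s : arrow Sg n m) z, x m s z <-> y m s z) -> x = y.
Proof.
by move=> xy; do 2!apply: functional_extensionality_dep => ?; apply: cset_eq.
Qed.

Lemma delta_natural (G H : psh Sg) (f : hom G H) :
  hom_eq (hom_comp (delta H) (fmap (Lb Sg) (fmap (R Sg) f)))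
    (hom_comp (fmap (R Sg) (fmap (Lb Sg) f)) (delta G)).
Proof.
move=> n xs; apply: R_ext => m s ys /=; rewrite -choices_map.
by rewrite -!map_comp.
Qed.

(** This is the multiplication axiom for a distributive law of the monad [Lb] over the functor
    [R]. *)
Lemma delta_concat (G : psh Sg) :
  hom_eq (hom_comp (delta G) (concat (R Sg G)))
    (hom_comp (fmap (R Sg) (concat G))
      (hom_comp (delta (Lb Sg G)) (fmap (Lb Sg) (delta G)))).
Proof.
move=> n xss; apply: R_ext => m s ys /=; rewrite -map_comp map_flatten.
by rewrite choices_flatten -map_comp.
Qed.

(** [LR] acts as the identity on labels, so only the second projections matter, and there
    [delta_natural] applies. *)
Lemma delta'_natural (Pr : predicates) (G H : psh Sg) (f : hom G H) :
  hom_eq (hom_comp (delta' Pr H) (fmap (Lb Sg) (fmap (LR Sg Pr) f)))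
    (hom_comp (fmap (LR Sg Pr) (fmap (Lb Sg) f)) (delta' Pr G)).
Proof.
move=> n xs; congr pair; first by rewrite /= -map_comp.
have /= <- := delta_natural f [seq x.2 | x <- xs].
by congr (happ (delta H) _); rewrite /= -!map_comp.
Qed.

Lemma coalg_hom_comp (F : functor Sg) (X Y Z : coalgebra F) (g : hom Y Z)
    (f : hom X Y) :
  is_coalg_hom g -> is_coalg_hom f -> is_coalg_hom (X := X) (Y := Z) (hom_comp g f).
Proof.
move=> gP fP n x; have /= -> := gP n (happ f x).
by have /= -> := fP n x; rewrite -[LHS](fmap_comp g f).
Qed.

Lemma corec_eq (F : functor Sg) (Z : final_coalgebra F) (X : coalgebra F)
    (f g : hom X Z) : is_coalg_hom f -> is_coalg_hom g -> hom_eq f g.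
Proof.
by move=> /corec_unique fE /corec_unique gE n x; rewrite fE gE.
Qed.

Section LogicProgram.
Variables (Pr : predicates) (P : program Sg Pr).

(** [psharp_delta] extends [psharp] from atoms to the free [Lb]-algebra on them, hence respects
    multiplication. *)
Lemma psharp_delta_concat :
  hom_eq (hom_comp (psharp_delta P) (concat (At Sg Pr)))
    (hom_comp (fmap (R Sg) (concat (At Sg Pr)))
      (hom_comp (delta (Lb Sg (At Sg Pr))) (fmap (Lb Sg) (psharp_delta P)))).
Proof.
move=> n ls.
set x := [seq [seq happ (psharp P) A | A <- l] | l <- ls].
set dx := [seq happ (delta (Lb Sg (At Sg Pr))) y | y <- x].
have E : [seq happ (psharp_delta P) l | l <- ls] =
    [seq happ (fmap (R Sg) (concat (At Sg Pr))) y | y <- dx].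
  by rewrite /dx /x -!map_comp.
have E1 := delta_concat x.
have E2 := delta_natural (concat (At Sg Pr)) dx.
transitivity (happ (fmap (R Sg) (concat (At Sg Pr)))
    (happ (delta (Lb Sg (At Sg Pr))) (flatten x))).
  by rewrite /= map_flatten.
transitivity (happ (fmap (R Sg) (concat (At Sg Pr)))
    (happ (delta (Lb Sg (At Sg Pr)))
      [seq happ (fmap (R Sg) (concat (At Sg Pr))) y | y <- dx])); last first.
  by rewrite -E.
(* Both sides become images of [happ (delta _) dx]: the left under [concat] after [concat], the
   right under [concat] after [fmap (Lb Sg) (concat _)]. Associativity of concatenation identifies
   the two. *)
rewrite [happ (delta _) (flatten x)]E1.
rewrite [happ (delta _) (map _ dx)]E2.
do 2!apply: functional_extensionality_dep => ?; rewrite /=.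
rewrite -!cset_map_comp; congr cset_map; apply/funext => z /=.
exact: flatten_flatten.
Qed.

(** The lifting of [Lb] to coalgebras along [delta']; at [Omega] it is the coalgebra whose
    corecursive map defines [concat_bar]. *)
Definition lift_coalgebra (X : coalgebra (LR Sg Pr)) : coalgebra (LR Sg Pr) :=
  @Coalgebra Sg (LR Sg Pr) (Lb Sg X)
    (hom_comp (delta' Pr X) (fmap (Lb Sg) (costr X))).

Lemma lift_coalg_hom (X Y : coalgebra (LR Sg Pr)) (f : hom X Y) :
  is_coalg_hom f ->
  is_coalg_hom (X := lift_coalgebra X) (Y := lift_coalgebra Y) (fmap (Lb Sg) f).
Proof.
move=> fP n x.
have E := delta'_natural f [seq happ (costr X) y | y <- x].
rewrite [RHS](esym E); congr (happ (delta' Pr Y) _).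
by rewrite /= -!map_comp; apply: eq_map => y; exact: fP.
Qed.

(** The label of a goal is the goal itself, so the first components agree at once; the second ones
    are [psharp_delta_concat]. *)
Lemma concat_coalg_hom :
  is_coalg_hom (X := lift_coalgebra (goal_coalgebra P)) (Y := goal_coalgebra P)
    (concat (At Sg Pr)).
Proof.
move=> n ls; congr pair; first by rewrite /= -map_comp map_id.
have E := psharp_delta_concat ls.
by rewrite [LHS]E /= -map_comp.
Qed.

Lemma semantics_concat (Omega : final_coalgebra (LR Sg Pr)) :
  hom_eq (hom_comp (semantics P Omega) (concat (At Sg Pr)))
    (hom_comp (concat_bar Omega) (fmap (Lb Sg) (semantics P Omega))).
Proof.
apply: (corec_eq (X := lift_coalgebra (goal_coalgebra P))).
  apply: (coalg_hom_comp (Y := goal_coalgebra P)) concat_coalg_hom.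
  exact: corec_hom.
apply: (coalg_hom_comp (Y := lift_coalgebra Omega)); first exact: corec_hom.
exact/lift_coalg_hom/corec_hom.
Qed.

End LogicProgram.
End DistributiveLaw.

Theorem theorem9p9 (Sg : signature) (Pr : predicates) (P : program Sg Pr)
    (Omega : final_coalgebra (LR Sg Pr)) (n m : nat)
    (ls : seq (Lb Sg (At Sg Pr) n)) (theta : arrow Sg n m) :
  happ (semantics P Omega)
    (happ (concat (At Sg Pr)) [seq pmor (Lb Sg (At Sg Pr)) theta l | l <- ls])
  = happ (concat_bar Omega)
      [seq pmor Omega theta (happ (semantics P Omega) l) | l <- ls]
  /\
  happ (concat_bar Omega)
    [seq pmor Omega theta (happ (semantics P Omega) l) | l <- ls]
  = pmor Omega theta
      (happ (concat_bar Omega) [seq happ (semantics P Omega) l | l <- ls]).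
Proof.
split.
  (* Compositionality is used at the already substituted lists; naturality of [semantics] then moves
     [theta] outside in each entry. *)
  have E := semantics_concat P Omega [seq pmor (Lb Sg (At Sg Pr)) theta l | l <- ls].
  rewrite [LHS]E; congr (happ (concat_bar Omega) _); rewrite /= -map_comp.
  by apply: eq_map => l; exact: hnat.
rewrite -hnat; congr (happ (concat_bar Omega) _).
by rewrite /= -map_comp.
Qed.
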